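(* Let $n\ge2$, let $K\subset\mathbb{R}^n$ be a convex body that is not a single point, and let $C\subset\mathbb{R}^n$ be a Minkowski-centered convex body with $0$ in its interior. Then $$\frac{n+1}{2n}\le\frac{D_{\mathrm{MIN}}(K,C)}{2R(K,C)}.$$ Moreover, equality can be obtained only if $K$ is an ($n$-dimensional) simplex. For every $s_C\in[1,n]$ there exist a Minkowski-centered convex body $C\subset\mathbb{R}^n$ with $0$ in its interior and $s(C)=s_C$, and a simplex $K$, such that the inequality is tight.
   Context: A convex body is a nonempty compact convex set. $\|x\|_C=\min\{\lambda\ge0:x\in\lambda C\}$ is the gauge function. The circumradius is $R(K,C)=\inf\{\rho\ge0:\exists t,\ K\subset t+\rho C\}$. The Minkowski asymmetry is $s(C)=R(C,-C)$, and $C$ is Minkowski-centered if $C\subset -s(C)C$. The minimum diameter is $D_{\mathrm{MIN}}(K,C)=\max_{x,y\in K}\|x-y\|_C$. *)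

(* Defs.v *)
From HB Require Import structures.
From mathcomp Require Import all_boot all_order all_algebra.
From mathcomp Require Import all_classical all_reals all_analysis.

Set Implicit Arguments.
Unset Strict Implicit.
Unset Printing Implicit Defensive.

Import Order.TTheory GRing.Theory Num.Theory.
Import numFieldNormedType.Exports.

Local Open Scope classical_set_scope.
Local Open Scope ring_scope.

Section ConvexBodies.
Context {R : realType} {n : nat}.
Implicit Types (K C A : set 'rV[R]_n) (x t : 'rV[R]_n) (l : R).

Definition convex_body K := [/\ K !=set0, compact K & convex_set K].

Definition dilate l A : set 'rV[R]_n := (fun x => l *: x) @` A.

Definition translate t A : set 'rV[R]_n := (fun x => t + x) @` A.

(* If C is compact with 0 in its interior, the infimum is a minimum. *)
Definition gauge C x : R := inf [set l | 0 <= l /\ dilate l C x].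

Definition circumradius K C : R :=
  inf [set rho | 0 <= rho /\ exists t, K `<=` translate t (dilate rho C)].

Definition minkowski_asymmetry C : R := circumradius C (-%R @` C).

Definition minkowski_centered C := C `<=` dilate (- minkowski_asymmetry C) C.

(* The supremum is a maximum when K is a convex body and C is a convex body
   with 0 in its interior. *)
Definition min_diameter K C : R :=
  sup [set d | exists x y, [/\ K x, K y & d = gauge C (x - y)]].

Definition conv_hull A : set 'rV[R]_n :=
  smallest [set B : set 'rV[R]_n | convex_set B] A.

Definition affinely_independent (m : nat) (p : 'I_m -> 'rV[R]_n) :=
  forall a : 'I_m -> R,
    \sum_i a i = 0 -> \sum_i a i *: p i = 0 -> forall i, a i = 0.

(* Full-dimensional: n + 1 vertices in R^n. *)
Definition is_simplex K := exists p : 'I_n.+1 -> 'rV[R]_n,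
  affinely_independent p /\ K = conv_hull (range p).

End ConvexBodies.

(* Main.v *)
Require Import Defs.
From HB Require Import structures.
From mathcomp Require Import all_boot all_order all_algebra.
From mathcomp Require Import all_classical all_reals all_analysis.
From mathcomp Require Import ring lra.

Import Order.TTheory GRing.Theory Num.Theory.
Import numFieldNormedType.Exports.

Local Open Scope classical_set_scope.
Local Open Scope ring_scope.

(** Write [d] for the diameter of [K] and [r] for [n / (n + 1) * d], so that
    the claimed inequality reads [circumradius K C <= r], where the
    circumradius is positive because [C] is bounded and [K] has two points.

    The inequality is Bohnenblust's. The gauge being attained, every
    difference of points of [K] lies in [d C]. The difference between one of
    [n + 1] points of [K] and their centroid is a nonnegative combination of the
    differences with the [n] other points, of total weight [n / (n + 1)], so
    the centroid is a common point of the sets [p_i - r C]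
    ([centroid_radius]). By Helly's theorem, whose proof goes through Radon's
    argument ([helly_step], [helly_compact]), all the sets [x - r C] with [x]
    in [K] have a common point, which is the centre of a copy of [r C] that
    contains [K].

    For the case of equality, fix [n + 1] points of [K]. If they are affinely
    dependent, or if [K] is larger than their convex hull, then some [q] in
    [K] is an affine combination of them with a negative coefficient at a
    point [p_i]. Using [p_i - q] as well as the [p_i - p_j] represents [p_i]
    minus the centroid with a smaller total weight, and moving the centre
    slightly makes the factor smaller than [r] at all the points
    ([radius_drop]). So if [K] is not a simplex, every [n + 1] points of [K]
    have a circumradius smaller than [r]. By compactness this gain is uniform
    ([uniform_radius_drop]), and by Helly's theorem again [K] itself has a
    circumradius smaller than [r].

    For tightness, let [h_0], ..., [h_n] be the linear forms with sum zero
    that differ from the barycentric coordinates of the standard simplex [T]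
    by constants, and let [C] be defined by [- s <= h_i <= 1]. Then [T - T]
    lies in [C], so that the diameter is at most [1], while comparing the
    heights [h_i] of the vertices shows that the circumradius is at least
    [n / (n + 1)] ([std_simplex_circumradius]). The inequality makes both
    bounds equalities. The asymmetry is [s] because [C] contains, for each [i],
    a point with [h_i = - s] ([truncated_simplex_asymmetry]); this is where
    [s <= n] enters. *)

(** * Convex combinations *)

Section ConvexCombinations.
Set Implicit Arguments.
Unset Strict Implicit.
Context {R : realType} {n : nat}.
Local Notation V := 'rV[R]_n.
Implicit Types (A B C K : set V) (x y t : V) (l d : R).

Lemma convex_setP A : convex_set A <->
  forall x y l, 0 <= l <= 1 -> A x -> A y -> A (l *: x + (1 - l) *: y).
Proof.
split=> [cA x y l /andP[l0 l1] Ax Ay|cA x y l].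
  by have := cA x y (Itv01 l0 l1); rewrite !inE => /(_ Ax Ay).
by rewrite !inE; apply: cA; rewrite ge0 le1.
Qed.

Lemma convex_sum (I : finType) A (w : I -> R) (x : I -> V) : convex_set A ->
  (forall i, 0 <= w i) -> \sum_i w i = 1 -> (forall i, 0 < w i -> A (x i)) ->
  A (\sum_i w i *: x i).
Proof.
move=> /convex_setP cA w_ge0 w1 Ax.
have partial (s : seq I) : 0 < \sum_(i <- s) w i ->
    A ((\sum_(i <- s) w i)^-1 *: \sum_(i <- s) w i *: x i).
  elim: s => [|i s IHs]; first by rewrite big_nil ltxx.
  rewrite !big_cons; set W := \sum_(j <- s) _ => W_gt0.
  have W_ge0 : 0 <= W by apply: sumr_ge0.
  have [wi0|wi_neq0] := eqVneq (w i) 0.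
    by move: W_gt0; rewrite wi0 scale0r !add0r; apply: IHs.
  have wi_gt0 : 0 < w i by rewrite lt_def wi_neq0 w_ge0.
  move: IHs; rewrite -/W; have [W0 _|W_neq0 IHs] := eqVneq W 0.
    rewrite [\sum_(j <- s) w j *: x j]big1_seq => [|j /andP[_ js]].
      by rewrite W0 !addr0 scalerA mulVf // scale1r; apply: Ax.
    have := W0; rewrite /W => /eqP; rewrite psumr_eq0 // => /allP /(_ j js).
    by move=> /= /eqP ->; rewrite scale0r.
  have {}W_gt0' : 0 < W by rewrite lt_def W_neq0.
  have l01 : 0 <= w i / (w i + W) <= 1.
    by rewrite divr_ge0 ?(ltW W_gt0) //= ler_pdivrMr // mul1r lerDl.
  have := cA (x i) _ (w i / (w i + W)) l01 (Ax i wi_gt0) (IHs W_gt0').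
  have -> : w i / (w i + W) = (w i + W)^-1 * w i by rewrite mulrC.
  rewrite scalerDr !scalerA.
  have -> // : (1 - (w i + W)^-1 * w i) / W = (w i + W)^-1.
  by field; rewrite W_neq0 lt0r_neq0.
have := partial (index_enum I); rewrite w1 invr1 scale1r; apply; exact: ltr01.
Qed.

Lemma sub_conv_hull A : A `<=` conv_hull A.
Proof. exact: sub_gen_smallest. Qed.

Lemma conv_hull_convex A : convex_set (conv_hull A).
Proof.
apply/convex_setP => x y l l01 Ax Ay B [cB AB].
by have /convex_setP := cB; apply => //; [apply: Ax | apply: Ay].
Qed.

Lemma conv_hull_sub A B : convex_set B -> A `<=` B -> conv_hull A `<=` B.
Proof. exact: smallest_sub. Qed.

Lemma conv_hull_sum (I : finType) (w : I -> R) (p : I -> V) :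
  (forall i, 0 <= w i) -> \sum_i w i = 1 ->
  conv_hull (range p) (\sum_i w i *: p i).
Proof.
move=> w0 w1; apply: convex_sum => //; first exact: conv_hull_convex.
by move=> i _; apply: sub_conv_hull; exists i.
Qed.

Lemma dilate_convex l C : convex_set C -> convex_set (dilate l C).
Proof.
move=> /convex_setP cC; apply/convex_setP => _ _ k k01 [x Cx <-] [y Cy <-].
exists (k *: x + (1 - k) *: y); first exact: cC.
by rewrite scalerDr !scalerA mulrC [l * (1 - k)]mulrC.
Qed.

Lemma dilate0 l C : C 0 -> dilate l C 0.
Proof. by exists 0; rewrite ?scaler0. Qed.

(** Sublinearity of the gauge of [C], phrased through dilates to avoid the
    infimum. *)
Lemma dilate_sum (I : finType) C (w d : I -> R) (x : I -> V) :
  convex_set C -> C 0 -> (forall i, 0 <= w i) -> (forall i, 0 <= d i) ->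
  (forall i, 0 < w i -> dilate (d i) C (x i)) ->
  dilate (\sum_i w i * d i) C (\sum_i w i *: x i).
Proof.
move=> cC C0 w_ge0 d_ge0 Cx.
have wd_ge0 i : 0 <= w i * d i by rewrite mulr_ge0.
set D := \sum_i _.
have choice i : exists y, C y /\ w i *: x i = (w i * d i) *: y.
  have [->|wi0] := eqVneq (w i) 0; first by exists 0; rewrite mul0r !scale0r.
  have [|y Cy <-] := Cx i; first by rewrite lt_def wi0 w_ge0.
  by exists y; rewrite scalerA.
have [y yP] := boolp.choice choice.
have [D0|D_neq0] := eqVneq D 0.
  rewrite D0; exists 0 => //; rewrite scale0r big1 // => i _.
  have [_ ->] := yP i; move: D0 => /eqP; rewrite psumr_eq0 // => /allP.
  by move=> /(_ i (mem_index_enum i)) /eqP ->; rewrite scale0r.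
exists (\sum_i (w i * d i / D) *: y i).
  apply: convex_sum => // [i||i _]; last by case: (yP i).
    by rewrite mulr_ge0 // invr_ge0; apply: sumr_ge0.
  by rewrite -mulr_suml divff.
rewrite scaler_sumr; apply: eq_bigr => i _; have [_ ->] := yP i.
by rewrite scalerA mulrC divfK.
Qed.

Lemma dilateD C (l k : R) x y : convex_set C -> C 0 -> 0 <= l -> 0 <= k ->
  dilate l C x -> dilate k C y -> dilate (l + k) C (x + y).
Proof.
move=> cC C0 l0 k0 Cx Cy.
have := @dilate_sum bool C (fun=> 1) (fun b => if b then l else k)
  (fun b => if b then x else y) cC C0.
by rewrite !big_bool /= !mul1r !scale1r; apply=> // -[].
Qed.

Lemma dilate_le C (l k : R) x : convex_set C -> C 0 -> 0 <= l -> l <= k ->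
  dilate l C x -> dilate k C x.
Proof.
move=> cC C0 l0 lk Cx; rewrite -(subrKC l k) -[x]addr0.
by apply: dilateD => //; [rewrite subr_ge0 | apply: dilate0].
Qed.

End ConvexCombinations.

(** * Affine dependence, Radon and Helly *)

Section Helly.
Set Implicit Arguments.
Unset Strict Implicit.
Context {R : realType} {n : nat}.
Local Notation V := 'rV[R]_n.

(** Homogeneous coordinates turn affine relations between points into linear
    relations between rows. *)
Definition homogeneous_mx (m : nat) (p : 'I_m -> V) : 'M[R]_(m, n + 1) :=
  row_mx (\matrix_(i < m) p i) (const_mx 1).

Lemma mul_homogeneous_mx m (p : 'I_m -> V) (a : 'rV[R]_m) :
  a *m homogeneous_mx p =
  row_mx (\sum_i a 0 i *: p i) (const_mx (\sum_i a 0 i)).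
Proof.
rewrite mul_mx_row mulmx_sum_row; congr row_mx.
  by apply: eq_bigr => i _; rewrite rowK.
apply/rowP => j; rewrite !mxE; apply: eq_bigr => i _.
by rewrite mxE mulr1.
Qed.

Lemma affinely_independent_row_free m (p : 'I_m -> V) :
  affinely_independent p <-> row_free (homogeneous_mx p).
Proof.
split=> [indep|free a a0 ap0 i].
  rewrite -kermx_eq0; apply/eqP/row_matrixP => k; rewrite row0.
  have : row k (kermx (homogeneous_mx p)) *m homogeneous_mx p = 0.
    by rewrite -row_mul mulmx_ker row0.
  move: (row k _) => u; rewrite mul_homogeneous_mx -row_mx0.
  move=> /eq_row_mx[ap0 /rowP /(_ 0)]; rewrite [LHS]mxE [RHS]mxE => a0.
  by apply/rowP => i; rewrite [RHS]mxE (indep (u 0)).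
have : (\row_i a i) *m homogeneous_mx p = 0.
  rewrite mul_homogeneous_mx -row_mx0; congr row_mx.
    by rewrite -[RHS]ap0; apply: eq_bigr => j _; rewrite mxE.
  by apply/rowP => j; rewrite !mxE -[RHS]a0; apply: eq_bigr => k _; rewrite mxE.
move=> /eqP; rewrite mulmx_free_eq0 // => /eqP /rowP /(_ i).
by rewrite !mxE.
Qed.

Lemma affinely_dependent m (p : 'I_m -> V) : (n.+1 < m)%N ->
  ~ affinely_independent p.
Proof.
move=> lt_n_m /affinely_independent_row_free /eqP rk.
by have := rank_leq_col (homogeneous_mx p); rewrite rk addn1 leqNgt lt_n_m.
Qed.

Lemma barycentric_coordinates (p : 'I_n.+1 -> V) (q : V) :
  affinely_independent p ->
  exists mu : 'I_n.+1 -> R, \sum_i mu i = 1 /\ \sum_i mu i *: p i = q.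
Proof.
move=> /affinely_independent_row_free free.
have full : row_full (homogeneous_mx p).
  by move: free; rewrite /row_free /row_full => /eqP ->; rewrite addn1.
have /submxP[D] := submx_full (row_mx q (const_mx 1) : 'rV[R]_(n + 1)) full.
rewrite mul_homogeneous_mx => /eq_row_mx[qE /rowP /(_ 0)]; rewrite !mxE => D1.
by exists (D 0).
Qed.

Lemma affine_dependence m (p : 'I_m -> V) : ~ affinely_independent p ->
  exists (a : 'I_m -> R) (i : 'I_m),
    [/\ \sum_i a i = 0, \sum_i a i *: p i = 0 & a i < 0].
Proof.
move=> /existsNP[a] /not_implyP[a0] /not_implyP[ap0] /existsNP[i /eqP ai].
have [ai_lt0|ai_ge0] := ltP (a i) 0; first by exists a, i.
have ai_gt0 : 0 < a i by rewrite lt_def ai.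
exists (fun j => - a j), i; rewrite sumrN a0 oppr0 oppr_lt0; split => //.
by under eq_bigr do rewrite scaleNr; rewrite sumrN ap0 oppr0.
Qed.

(** The step of Helly's theorem. Leaving out one set at a time gives more than
    [n.+1] points; by Radon's argument an affine dependence between them,
    with the positive and the negative coefficients on different sides, exhibits
    one point as two convex combinations, and each of the sets contains all the
    points used by one of the two. *)
Lemma helly_step (T : Type) (D : set T) (A : T -> set V) k :
  (forall t, D t -> convex_set (A t)) -> (n < k)%N ->
  (forall f : 'I_k -> T, (forall i, D (f i)) ->
    exists x, forall i, A (f i) x) ->
  forall f : 'I_k.+1 -> T, (forall i, D (f i)) -> exists x, forall i, A (f i) x.
Proof.
move=> cA nk Ak f Df.
have choice i : exists x, forall j, j != i -> A (f j) x.
  have [j|x Ax] := Ak (fun j => f (lift i j)); first exact: Df.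
  exists x => j /[1!eq_sym] /unlift_some[j' -> _]; exact: Ax.
have [x xP] := boolp.choice choice.
have [a [i0 [a0 ax0 ai0]]] := affine_dependence (@affinely_dependent _ x nk).
have maxB (r : R) : Num.max r 0 - Num.max (- r) 0 = r.
  by rewrite !maxEle; case: (leP r 0) => ?; case: (leP (- r) 0) => ?; lra.
pose P := \sum_i Num.max (a i) 0.
have PE : P = \sum_i Num.max (- a i) 0.
  apply/eqP; rewrite -subr_eq0 -sumrB -[X in _ == X]a0; apply/eqP.
  by apply: eq_bigr => i _; rewrite maxB.
have P_gt0 : 0 < P.
  rewrite PE (bigD1 i0) //= ltr_wpDr ?sumr_ge0 // => [i _|].
    by rewrite le_max lexx orbT.
  by rewrite lt_max oppr_gt0 ai0.
have P_neq0 : P != 0 by rewrite gt_eqF.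
pose z := \sum_i (Num.max (a i) 0 / P) *: x i.
have zE : z = \sum_i (Num.max (- a i) 0 / P) *: x i.
  apply/eqP; rewrite -subr_eq0 -sumrB; apply/eqP.
  transitivity (P^-1 *: \sum_i a i *: x i); last by rewrite ax0 scaler0.
  rewrite scaler_sumr; apply: eq_bigr => i _.
  rewrite -scalerBl scalerA; congr (_ *: _).
  by rewrite -mulrBl maxB mulrC.
exists z => j; have [aj|aj] := leP (a j) 0.
  apply: convex_sum; first exact: cA.
  - by move=> i; rewrite mulr_ge0 ?invr_ge0 ?le_max ?lexx ?orbT // ltW.
  - by rewrite -mulr_suml divff.
  move=> i; rewrite pmulr_lgt0 ?invr_gt0 // lt_max ltxx orbF => ai.
  by apply: xP; apply: contraTneq ai => <-; rewrite -leNgt.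
rewrite zE; apply: convex_sum; first exact: cA.
- by move=> i; rewrite mulr_ge0 ?invr_ge0 ?le_max ?lexx ?orbT // ltW.
- by rewrite -mulr_suml -PE divff.
move=> i; rewrite pmulr_lgt0 ?invr_gt0 // lt_max ltxx orbF oppr_gt0 => ai.
by apply: xP; apply: contraTneq ai => <-; rewrite -leNgt ltW.
Qed.

Lemma helly_finite (T : Type) (D : set T) (A : T -> set V) k :
  (forall t, D t -> convex_set (A t)) -> (n < k)%N ->
  (forall f : 'I_n.+1 -> T, (forall i, D (f i)) ->
    exists x, forall i, A (f i) x) ->
  forall f : 'I_k -> T, (forall i, D (f i)) -> exists x, forall i, A (f i) x.
Proof.
move=> cA + An; elim: k => // k IHk; rewrite ltnS leq_eqVlt.
by case: eqVneq => [<-//|_ /=] nk; apply: helly_step => //; apply: IHk.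
Qed.

Lemma helly_compact (T : choiceType) (D : set T) (A : T -> set V) :
  (forall t, D t -> convex_set (A t)) -> (forall t, D t -> compact (A t)) ->
  (forall f : 'I_n.+1 -> T, (forall i, D (f i)) ->
    exists x, forall i, A (f i) x) ->
  exists x, forall t, D t -> A t x.
Proof.
move=> cA kA An.
have [D0|/nonemptyPn] := pselect (D !=set0); last first.
  by move=> D0; exists 0 => t; rewrite D0.
have [t0 Dt0] := D0.
have := kA _ Dt0; rewrite compact_In0 => /(_ T D (fun t => A t0 `&` A t)).
case.
- exists A => // t Dt; apply: compact_closed (kA t Dt); exact: norm_hausdorff.
- move=> S SD; pose s : seq T := finmap.enum_fset S.
  (* The default value of [nth] pads the list to a length to which the finite
     theorem applies, and makes [A t0] one of the sets. *)
  pose f (i : 'I_(size s + n.+1)) := nth t0 s i.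
  have Df i : D (f i).
    rewrite /f; have [lt_i|ge_i] := ltnP i (size s); last first.
      by rewrite nth_default.
    by have := SD (nth t0 s i); rewrite inE; apply; exact: mem_nth.
  have [|x Ax] := @helly_finite T D A _ cA _ An f Df; first by rewrite leq_addl.
  have At0 : A t0 x.
    have lt_last : (size s + n < size s + n.+1)%N by rewrite addnS.
    have := Ax (Ordinal lt_last); rewrite /f nth_default //=; exact: leq_addr.
  exists x => t /= ts; split=> //.
  have lt_t : (index t s < size s + n.+1)%N.
    by rewrite (leq_trans _ (leq_addr _ _)) // index_mem.
  by have := Ax (Ordinal lt_t); rewrite /f nth_index.
- by move=> x Ax; exists x => t Dt; case: (Ax t Dt).
Qed.

End Helly.

(** * Radius of finitely many points *)

Section FiniteRadius.
Set Implicit Arguments.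
Unset Strict Implicit.
Context {R : realType} {n : nat}.
Local Notation V := 'rV[R]_n.
Variables (C : set V) (d : R).
Hypotheses (cC : convex_set C) (C0 : C 0).

Lemma dilate_sub_barycenter m (p : 'I_m -> V) (w : 'I_m -> R) i :
  0 <= d -> (forall j, dilate d C (p i - p j)) ->
  \sum_j w j = 1 -> (forall j, j != i -> 0 <= w j) ->
  dilate ((1 - w i) * d) C (p i - \sum_j w j *: p j).
Proof.
move=> d_ge0 Cp w1 w_ge0.
pose v j := if j == i then 0 else w j.
have v_ge0 j : 0 <= v j by rewrite /v; case: eqVneq => // /w_ge0.
have := @dilate_sum R n _ C v (fun=> d) (fun j => p i - p j) cC C0 v_ge0.
move=> /(_ (fun=> d_ge0) (fun j _ => Cp j)).
have -> : \sum_j v j * d = (1 - w i) * d.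
  rewrite -mulr_suml -w1 (bigD1 i) //= [in RHS](bigD1 i) //= /v eqxx add0r.
  rewrite addrAC subrr add0r; congr (_ * _).
  by apply: eq_bigr => j /negPf ->.
have -> // : \sum_j v j *: (p i - p j) = p i - \sum_j w j *: p j.
have {2}-> : p i = \sum_j w j *: p i by rewrite -scaler_suml w1 scale1r.
rewrite -sumrB; apply: eq_bigr => j _; rewrite -scalerBr /v.
by case: eqVneq => // ->; rewrite subrr !scaler0.
Qed.

(** At the centroid each of the [n.+1] points has weight [1 / n.+1], which
    leaves the factor [n / n.+1] for the others. *)
Lemma centroid_radius (p : 'I_n.+1 -> V) :
  0 <= d -> (forall i j, dilate d C (p i - p j)) ->
  exists t, forall i, dilate (n%:R / n.+1%:R * d) C (p i - t).
Proof.
move=> d_ge0 Cp; have N_neq0 : n.+1%:R != 0 :> R by rewrite pnatr_eq0.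
exists (\sum_j n.+1%:R^-1 *: p j) => i.
have -> : n%:R / n.+1%:R = 1 - n.+1%:R^-1 :> R.
  by rewrite -natr1 in N_neq0 *; field.
apply: (@dilate_sub_barycenter _ p (fun=> n.+1%:R^-1)) => //.
by rewrite sumr_const card_ord -[_ *+ _]mulr_natr mulVf.
Qed.

(** If some [q] with a negative barycentric coordinate at [p i] is still within
    [d] of [p i], then mixing a little of [p i - q] into the combination
    of the [p i - p j] that represents [p i] minus the centroid reaches the
    centroid with a smaller total weight: there is slack at [p i]. Moving the
    centre slightly away from [p i] distributes this slack over all the
    points. *)
Lemma radius_drop (p : 'I_n.+1 -> V) (mu : 'I_n.+1 -> R) i :
  (0 < n)%N -> 0 < d -> (forall i j, dilate d C (p i - p j)) ->
  \sum_j mu j = 1 -> mu i < 0 -> dilate d C (p i - \sum_j mu j *: p j) ->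
  exists (r : R) t, [/\ 0 <= r, r < n%:R / n.+1%:R * d &
    forall j, dilate r C (p j - t)].
Proof.
move=> n_gt0 d_gt0 Cp mu1 mui Cq.
pose M := \sum_j `|mu j|; pose N : R := n.+1%:R.
have leM j : `|mu j| <= M.
  by rewrite /M (bigD1 j) //= lerDl sumr_ge0.
have M_gt0 : 0 < M by rewrite (lt_le_trans _ (leM i)) // normr_gt0 lt_eqF.
have N_gt0 : 0 < N by rewrite ltr0n.
have NE : N = n%:R + 1 by rewrite /N -natr1.
have n_ge1 : 1 <= n%:R :> R by rewrite ler1n.
have [N_neq0 M_neq0] : N != 0 /\ M != 0 by rewrite !gt_eqF.
(* [e] is the amount of [p i - q], small enough for the coefficients [v] below
   to stay nonnegative; [del] is the share of each of the [N] points in the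
   resulting slack [e * - mu i]. *)
pose e := N^-1 / M; pose del := e * - mu i / N.
have e_gt0 : 0 < e by rewrite divr_gt0 ?invr_gt0.
have del_gt0 : 0 < del by rewrite divr_gt0 // mulr_gt0 // oppr_gt0.
have e_mu j : e * `|mu j| <= N^-1.
  rewrite /e -mulrA ler_piMr ?invr_ge0 ?(ltW N_gt0) //.
  by rewrite ler_pdivrMl ?mulr1.
have Ndel : N * del = e * `|mu i|.
  by rewrite ltr0_norm // /del; field.
pose w j := N^-1 + del - (if j == i then N * del else 0).
have w1 : \sum_j w j = 1.
  rewrite sumrB sumr_const card_ord -big_mkcond big_pred1_eq.
  by rewrite -[_ *+ _]mulr_natr -/N; field.
have w_ge0 j : 0 <= w j.
  rewrite /w; case: ifP => _.
    by rewrite Ndel addrAC addr_ge0 ?subr_ge0 ?(ltW del_gt0).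
  by rewrite subr0 addr_ge0 ?invr_ge0 ?(ltW N_gt0) ?(ltW del_gt0).
have rE : n%:R / N = 1 - N^-1 by rewrite NE in N_neq0 *; field.
rewrite -/N; clearbody del e M N.
exists ((n%:R / N - del) * d), (\sum_j w j *: p j); split.
- rewrite mulr_ge0 ?(ltW d_gt0) // subr_ge0.
  have delN : del <= N^-1.
    by have := e_mu i; rewrite -Ndel; have := del_gt0; nra.
  by rewrite (le_trans delN) // -[leLHS]mul1r ler_pM2r ?invr_gt0.
- by rewrite ltr_pM2r // gtrBl.
move=> j; have [->|ji] := eqVneq j i; last first.
  have -> : n%:R / N - del = 1 - w j by rewrite rE /w (negPf ji); lra.
  by apply: dilate_sub_barycenter => //; exact: ltW.
pose v j := w j - e * mu j + (if j == i then e else 0).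
have v1 : \sum_j v j = 1.
  rewrite big_split /= sumrB w1 -mulr_sumr mu1 -big_mkcond big_pred1_eq.
  by rewrite mulr1 subrK.
have v_ge0 k : k != i -> 0 <= v k.
  move=> ki; rewrite /v /w (negPf ki); have := e_mu k.
  by have := ler_norm (mu k); have := e_gt0; have := del_gt0; nra.
have -> : n%:R / N - del = e + (1 - v i).
  rewrite rE /v /w eqxx Ndel ltr0_norm //; move: Ndel.
  by rewrite ltr0_norm //; lra.
have -> : p i - \sum_j w j *: p j =
    e *: (p i - \sum_j mu j *: p j) + (p i - \sum_j v j *: p j).
  have -> : \sum_j v j *: p j =
      \sum_j w j *: p j - e *: (\sum_j mu j *: p j) + e *: p i.
    have -> : p i = \sum_j (if j == i then p j else 0).
      by rewrite -big_mkcond big_pred1_eq.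
    rewrite !scaler_sumr -sumrB -big_split; apply: eq_bigr => k _ /=.
    rewrite /v scalerDl scalerBl scalerA; congr (_ + _).
    by case: eqVneq => //; rewrite ?scale0r ?scaler0.
  by apply/rowP => k; rewrite !mxE; ring.
rewrite mulrDl; apply: dilateD => //.
- by rewrite mulr_ge0 // ltW.
- rewrite mulr_ge0 ?(ltW d_gt0) // -v1 (bigD1 i) //= addrAC subrr add0r.
  exact: sumr_ge0.
- by case: Cq => y Cy <-; exists y; rewrite ?scalerA.
- by apply: dilate_sub_barycenter => //; exact: ltW.
Qed.

(** Both failures of the second alternative feed [radius_drop]: an affine
    dependence between the [p i] yields coordinates of some [p i] with a
    negative entry at [i], and a point of [K] outside the simplex spanned by
    the [p i] has a negative barycentric coordinate. *)
Lemma radius_drop_or_simplex (K : set V) (p : 'I_n.+1 -> V) :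
  (0 < n)%N -> 0 < d -> convex_set K ->
  (forall x y, K x -> K y -> dilate d C (x - y)) -> (forall i, K (p i)) ->
  (exists (r : R) t, [/\ 0 <= r, r < n%:R / n.+1%:R * d &
    forall j, dilate r C (p j - t)]) \/
  (affinely_independent p /\ K = conv_hull (range p)).
Proof.
move=> n_gt0 d_gt0 cK CK Kp.
have [|no_drop] := pselect (exists (r : R) t,
    [/\ 0 <= r, r < n%:R / n.+1%:R * d & forall j, dilate r C (p j - t)]);
  [by left | right].
have mu_ge0 (mu : 'I_n.+1 -> R) i : \sum_j mu j = 1 ->
    K (\sum_j mu j *: p j) -> 0 <= mu i.
  move=> mu1 Kq; rewrite leNgt; apply/negP => mui; apply: no_drop.
  by apply: (radius_drop (mu := mu) (i := i)) => // [j k|]; apply: CK.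
have indep : affinely_independent p.
  apply: contrapT => /affine_dependence[a [i [a0 ap0 ai]]].
  (* The coordinate at [i] becomes [1 - 2]. *)
  pose mu j := (if j == i then 1 else 0) - 2 / a i * a j.
  have ai_neq0 : a i != 0 by rewrite lt_eqF.
  have mui : mu i = - 1 by rewrite /mu eqxx; field.
  have : 0 <= mu i; last by rewrite mui oppr_ge0 ler10.
  apply: mu_ge0.
    by rewrite sumrB -mulr_sumr a0 mulr0 subr0 -big_mkcond big_pred1_eq.
  have -> : \sum_j mu j *: p j = p i; last exact: Kp.
  transitivity (\sum_j (if j == i then p j else 0) -
                (2 / a i) *: \sum_j a j *: p j).
    rewrite scaler_sumr -sumrB; apply: eq_bigr => j _.
    by rewrite scalerBl scalerA; case: ifP; rewrite ?scale1r ?scale0r.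
  by rewrite ap0 scaler0 subr0 -big_mkcond big_pred1_eq.
split=> //; apply/seteqP; split=> [q Kq|]; last first.
  by apply: conv_hull_sub => // _ [i _ <-].
have [mu [mu1 qE]] := barycentric_coordinates q indep.
rewrite -qE; apply: conv_hull_sum => // i.
by apply: mu_ge0 => //; rewrite qE.
Qed.

End FiniteRadius.

(** * Circumradius and diameter *)

Section Radius.
Set Implicit Arguments.
Unset Strict Implicit.
Context {R : realType} {n : nat}.
Local Notation V := 'rV[R]_n.
Implicit Types (C K : set V) (x t : V).

Lemma translate_dilateP t r C x :
  translate t (dilate r C) x <-> dilate r C (x - t).
Proof.
split=> [[y Cy <-]|Cx]; first by rewrite addrAC subrr add0r.
by exists (x - t); rewrite ?subrKC // addrC subrK.
Qed.

Lemma circumradius_le K C r t : 0 <= r ->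
  (forall x, K x -> dilate r C (x - t)) -> circumradius K C <= r.
Proof.
move=> r_ge0 CK; apply: ge_inf; first by exists 0 => s [].
by split=> //; exists t => x /CK; exact: (translate_dilateP _ _ _ _).2.
Qed.

Lemma circumradius_ge K C r0 t0 b : 0 <= r0 ->
  (forall x, K x -> dilate r0 C (x - t0)) ->
  (forall r t, 0 <= r -> (forall x, K x -> dilate r C (x - t)) -> b <= r) ->
  b <= circumradius K C.
Proof.
move=> r0_ge0 CK lb; apply: lb_le_inf.
  exists r0; split=> //; exists t0 => x /CK.
  exact: (translate_dilateP _ _ _ _).2.
move=> r [r_ge0 [t Kt]]; apply: (lb r t) => // x /Kt.
exact: (translate_dilateP _ _ _ _).1.
Qed.

Lemma interior0_ball C : interior C 0 ->
  exists2 r : R, 0 < r & forall x, `|x| < r -> C x.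
Proof.
rewrite /interior /= => /nbhs_normP[r /= r_gt0 rC]; exists r => // x xr.
by apply: rC; rewrite /ball_ /= sub0r normrN.
Qed.

Lemma compact_norm_le C : compact C ->
  exists2 M : R, 0 < M & forall x, C x -> `|x| <= M.
Proof.
move=> /compact_bounded[M [_ bM]]; exists (Num.max 1 (M + 1)).
  by rewrite lt_max ltr01.
by move=> x Cx; apply: bM => //; rewrite lt_max ltrDl ltr01 orbT.
Qed.

Section Gauge.
Variable C : set V.
Hypotheses (cC : convex_set C) (kC : compact C) (C0 : interior C 0).

Let C_0 : C 0. Proof. exact: interior_subset. Qed.

Lemma dilate_of_norm_lt : exists2 r : R, 0 < r &
  forall d x, 0 < d -> `|x| < d * r -> dilate d C x.
Proof.
have [r r_gt0 rC] := interior0_ball C0; exists r => // d x d_gt0 xdr.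
exists (d^-1 *: x); last by rewrite scalerA divff ?scale1r ?gt_eqF.
by apply: rC; rewrite normrZ gtr0_norm ?invr_gt0 // ltr_pdivrMl.
Qed.

Lemma dilate_exists x : exists l, 0 <= l /\ dilate l C x.
Proof.
have [r r_gt0 rC] := dilate_of_norm_lt.
have x1_gt0 : 0 < (`|x| + 1) / r by rewrite divr_gt0 // ltr_wpDl.
exists ((`|x| + 1) / r); split; first exact: ltW.
by apply: rC => //; rewrite divfK ?gt_eqF // ltrDl.
Qed.

Lemma gauge_le d x : 0 <= d -> dilate d C x -> gauge C x <= d.
Proof. by move=> d0 Cx; apply: ge_inf => //; exists 0 => s []. Qed.

Lemma norm_le_gauge : exists2 M : R, 0 < M & forall x, `|x| <= M * gauge C x.
Proof.
have [M M_gt0 CM] := compact_norm_le kC; exists M => // x.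
rewrite -ler_pdivrMl //; apply: lb_le_inf; first exact: dilate_exists.
move=> l [l_ge0 [y Cy <-]]; rewrite ler_pdivrMl // normrZ ger0_norm // mulrC.
by rewrite ler_wpM2r // CM.
Qed.

(** Attainment of the infimum, by closedness of [C]. *)
Lemma dilate_gauge_le d x : 0 < d -> gauge C x <= d -> dilate d C x.
Proof.
move=> d_gt0 gd; have closedC : closed C.
  by apply: compact_closed kC; exact: norm_hausdorff.
exists (d^-1 *: x); last by rewrite scalerA divff ?scale1r ?gt_eqF.
have : l^-1 *: x @[l --> d^'+] --> d^-1 *: x.
  apply: cvgZ; last exact: cvg_cst.
  by apply: cvg_at_right_filter; apply: cvgV; rewrite ?gt_eqF.
apply: (closed_cvg C closedC).
near=> l; have dl : d < l by [].
have [||k [k_ge0 Ck] kl] := @inf_lt R [set k | 0 <= k /\ dilate k C x] l.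
- exact: dilate_exists.
- exact: le_lt_trans gd dl.
have [y Cy <-] := dilate_le cC C_0 k_ge0 (ltW kl) Ck.
by rewrite scalerA mulVf ?scale1r // gt_eqF // (lt_trans d_gt0).
Unshelve. all: by end_near. Qed.

(** The gauge is bounded on differences of points of a compact set, so that the
    supremum in the diameter is a genuine one. *)
Lemma gauge_le_min_diameter K x y : compact K -> K x -> K y ->
  gauge C (x - y) <= min_diameter K C.
Proof.
move=> /compact_norm_le[M M_gt0 KM] Kx Ky.
have [r r_gt0 rC] := dilate_of_norm_lt.
apply: ub_le_sup; last by exists x, y.
exists ((M + M + 1) / r) => _ [a [b [Ka Kb ->]]].
have d_gt0 : 0 < (M + M + 1) / r by rewrite divr_gt0 // addr_gt0 ?addr_gt0.
apply: gauge_le; first exact: ltW.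
apply: rC => //; rewrite divfK ?gt_eqF // (le_lt_trans (ler_normB _ _)) //.
by rewrite ltr_pwDr // lerD ?KM.
Qed.

Lemma min_diameter_le K d : K !=set0 -> 0 <= d ->
  (forall x y, K x -> K y -> dilate d C (x - y)) -> min_diameter K C <= d.
Proof.
move=> [x Kx] d_ge0 CK; apply: ge_sup; first by exists (gauge C (x - x)), x, x.
by move=> _ [a [b [Ka Kb ->]]]; apply: gauge_le => //; apply: CK.
Qed.

Lemma min_diameter_gt0 K x y : compact K -> K x -> K y -> x != y ->
  0 < min_diameter K C.
Proof.
move=> kK Kx Ky xy; have [M M_gt0 xM] := norm_le_gauge.
rewrite (lt_le_trans _ (gauge_le_min_diameter kK Kx Ky)) //.
by rewrite -(pmulr_rgt0 _ M_gt0) (lt_le_trans _ (xM _)) // normr_gt0 subr_eq0.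
Qed.

Lemma circumradius_gt0 K x y r0 t0 : K x -> K y -> x != y -> 0 <= r0 ->
  (forall x, K x -> dilate r0 C (x - t0)) -> 0 < circumradius K C.
Proof.
move=> Kx Ky xy r0_ge0 CK; have [M M_gt0 CM] := compact_norm_le kC.
have b_gt0 : 0 < `|x - y| / (M + M).
  by rewrite divr_gt0 ?addr_gt0 // normr_gt0 subr_eq0.
rewrite (lt_le_trans b_gt0) //; apply: (circumradius_ge r0_ge0 CK).
move=> r t r_ge0 {}CK; rewrite ler_pdivrMr ?addr_gt0 //.
have [[u Cu xE] [v Cv yE]] := (CK x Kx, CK y Ky).
have -> : x - y = r *: (u - v) by rewrite scalerBr xE yE opprB addrA subrK.
rewrite normrZ ger0_norm // ler_wpM2l // (le_trans (ler_normB _ _)) //.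
by rewrite lerD ?CM.
Qed.

(** The admissible centres for a single point [x] form the compact convex set
    [x - r *: C], so Helly's theorem reduces the search for a centre to
    [n.+1] points at a time. *)
Lemma helly_dilate K r : 0 <= r ->
  (forall p : 'I_n.+1 -> V, (forall i, K (p i)) ->
    exists t, forall i, dilate r C (p i - t)) ->
  exists t, forall x, K x -> dilate r C (x - t).
Proof.
move=> r_ge0 Kp.
apply: (@helly_compact R n V K (fun x t => dilate r C (x - t))).
- move=> x _; apply/convex_setP => s t l l01 Cs Ct.
  have /convex_setP /(_ _ _ l l01 Cs Ct) := dilate_convex (l := r) cC.
  have -> // : l *: (x - s) + (1 - l) *: (x - t) =
      x - (l *: s + (1 - l) *: t).
  by apply/rowP => k; rewrite !mxE; ring.
- move=> x _.
  have -> : (fun t => dilate r C (x - t)) = (fun y => x - r *: y) @` C.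
    apply/seteqP; split=> [t [y Cy yE]|_ [y Cy <-]].
      by exists y => //; rewrite yE subKr.
    by exists y => //; rewrite subKr.
  apply: continuous_compact => //; apply: continuous_subspaceT.
  move=> y; apply: continuousB; first exact: cst_continuous.
  exact: scaler_continuous.
- exact: Kp.
Qed.

(** Uniformity over all [n.+1]-tuples of points of a compact set: a common
    radius works near a given tuple, since [C] is a neighbourhood of [0], and
    the set of tuples is compact. *)
Lemma uniform_radius_drop K (r0 : R) : compact K -> 0 < r0 ->
  (forall p : 'I_n.+1 -> V, (forall i, K (p i)) ->
    exists (r : R) t, [/\ 0 <= r, r < r0 & forall i, dilate r C (p i - t)]) ->
  exists2 r, 0 <= r < r0 & forall p : 'I_n.+1 -> V, (forall i, K (p i)) ->
    exists t, forall i, dilate r C (p i - t).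
Proof.
move=> kK r0_gt0 Kp.
have /compact_near_coveringP near_cov :=
  @tychonoff 'I_n.+1 (fun=> V) (fun=> K) (fun=> kK).
have [rho rho_gt0 rhoC] := dilate_of_norm_lt.
have drop_near : \forall s \near r0^'-,
    [set p : 'I_n.+1 -> V | forall i, K (p i)] `<=`
    [set p | exists t, forall i, dilate s C (p i - t)].
  apply: near_cov => p /Kp[r [t [r_ge0 r_lt Cp]]].
  pose e := (r0 - r) / 2; have e_gt0 : 0 < e by rewrite divr_gt0 // subr_gt0.
  have re_lt : r + e < r0 by rewrite /e; lra.
  pose tuples := prod_topology (fun _ : 'I_n.+1 => V).
  have FF : Filter (nbhs (p : tuples)) := nbhs_filter _.
  have near_p : \forall q \near (p : tuples), forall i, `|q i - p i| < e * rho.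
    apply: (@filter_forall _ _ _ _ FF) => i.
    have := @proj_continuous _ (fun=> V) i p.
    move=> /cvgrPdist_lt /(_ (e * rho)) /(_ (mulr_gt0 e_gt0 rho_gt0)).
    by apply: (@filterS _ _ FF) => q; rewrite distrC.
  exists ([set q | forall i, `|q i - p i| < e * rho], [set s | r + e <= s]).
    by split=> //; apply: nbhs_left_ge.
  move=> [q s] [/= q_near re_s]; exists t => i.
  have -> : q i - t = (p i - t) + (q i - p i) by rewrite [RHS]addrC addrA subrK.
  apply: (@dilate_le _ _ C (r + e)) => //; first by rewrite addr_ge0 // ltW.
  by apply: dilateD => //; [exact: ltW | apply: rhoC].
have : \forall s \near r0^'-, (exists2 r, 0 <= r < r0 &
    forall p : 'I_n.+1 -> V, (forall i, K (p i)) ->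
      exists t, forall i, dilate r C (p i - t)).
  near=> s; exists s; last exact: (near drop_near s).
  apply/andP; split; near: s; [exact: nbhs_left_ge | exact: nbhs_left_lt].
by move=> /filter_ex[].
Unshelve. all: by end_near. Qed.

(** Bohnenblust's bound and its case of equality: Helly's theorem is applied
    to the factor given by centroids, and, if [K] is not a simplex, a second
    time to the smaller factor given by [uniform_radius_drop]. *)
Lemma circumradius_le_min_diameter K : (0 < n)%N ->
  convex_body K -> ~ (exists x, K = [set x]) ->
  let r := n%:R / n.+1%:R * min_diameter K C in
  [/\ 0 < circumradius K C, circumradius K C <= r &
      r <= circumradius K C -> is_simplex K].
Proof.
move=> n_gt0 [[x Kx] kK cK] Kx1; set d := min_diameter K C; move=> r.
have [y Ky xy] : exists2 y, K y & x != y.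
  apply: contrapT => noy; apply: Kx1; exists x.
  apply/seteqP; split=> [y Ky|_ -> //].
  by apply: contrapT => /eqP; rewrite eq_sym => xy; apply: noy; exists y.
have d_gt0 : 0 < d := min_diameter_gt0 kK Kx Ky xy.
have CK a b : K a -> K b -> dilate d C (a - b).
  by move=> Ka Kb; apply: dilate_gauge_le => //; apply: gauge_le_min_diameter.
have r_gt0 : 0 < r by rewrite mulr_gt0 // divr_gt0 ?ltr0n.
have [t Ct] : exists t, forall x, K x -> dilate r C (x - t).
  apply: helly_dilate; first exact: ltW.
  move=> p Kp; apply: centroid_radius => //; first exact: ltW.
  by move=> i j; apply: CK.
split.
- exact: circumradius_gt0 Kx Ky xy (ltW r_gt0) Ct.
- exact: circumradius_le (ltW r_gt0) Ct.
move=> r_le; apply: contrapT => not_simplex.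
have [s /andP[s_ge0 s_lt] Cs] : exists2 s, 0 <= s < r &
    forall p : 'I_n.+1 -> V, (forall i, K (p i)) ->
      exists t, forall i, dilate s C (p i - t).
  apply: uniform_radius_drop => // p Kp.
  case: (radius_drop_or_simplex cC C_0 n_gt0 d_gt0 cK CK Kp) => // -[indep KE].
  by case: not_simplex; exists p.
have [c Cc] := helly_dilate s_ge0 Cs.
by have := circumradius_le s_ge0 Cc; rewrite leNgt (lt_le_trans s_lt).
Qed.

End Gauge.
End Radius.

(** * Extremal bodies *)

Section Extremal.
Set Implicit Arguments.
Unset Strict Implicit.
Context {R : realType} {n : nat}.
Local Notation V := 'rV[R]_n.
Implicit Types (x y t : V) (a b : 'I_n.+1 -> R) (i : 'I_n.+1).

(** The linear parts of the barycentric coordinates with respect to the origin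
    and the standard basis. They identify [V] with the vectors of
    coordinate sum zero in dimension [n.+1], which makes all the facets of the
    simplex alike. *)
Definition facet_form x i : R :=
  if unlift ord0 i is Some j then x 0 j else - \sum_j x 0 j.

Definition vertex i : V :=
  if unlift ord0 i is Some j then delta_mx 0 j else 0.

Definition slab a b : set V := [set x | forall i, a i <= facet_form x i <= b i].

Lemma facet_form_lift x j : facet_form x (lift ord0 j) = x 0 j.
Proof. by rewrite /facet_form liftK. Qed.

Lemma facet_form0 x : facet_form x ord0 = - \sum_j x 0 j.
Proof. by rewrite /facet_form unlift_none. Qed.

Lemma facet_form_linear k x y i :
  facet_form (k *: x + y) i = k * facet_form x i + facet_form y i.
Proof.
rewrite /facet_form; case: unlift => [j|]; first by rewrite !mxE.
under eq_bigr do rewrite !mxE.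
by rewrite big_split /= -mulr_sumr opprD mulrN.
Qed.

Lemma facet_formZ k x i : facet_form (k *: x) i = k * facet_form x i.
Proof.
have zero : facet_form 0 i = 0.
  by have := facet_form_linear 1 0 0 i; rewrite scaler0 addr0; lra.
by rewrite -[k *: x]addr0 facet_form_linear zero addr0.
Qed.

Lemma facet_formB x y i :
  facet_form (x - y) i = facet_form x i - facet_form y i.
Proof. by rewrite addrC -scaleN1r facet_form_linear mulN1r addrC. Qed.

Lemma facet_formN x i : facet_form (- x) i = - facet_form x i.
Proof. by rewrite -scaleN1r facet_formZ mulN1r. Qed.

Lemma sum_facet_form x : \sum_i facet_form x i = 0.
Proof.
rewrite big_ord_recl; under eq_bigr do rewrite facet_form_lift.
by rewrite facet_form0 addNr.
Qed.

Lemma facet_form_onto (g : 'I_n.+1 -> R) : \sum_i g i = 0 ->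
  exists x, forall i, facet_form x i = g i.
Proof.
rewrite big_ord_recl => g0; exists (\row_j g (lift ord0 j)) => i.
case: (unliftP ord0 i) => [j ->|->]; first by rewrite facet_form_lift mxE.
rewrite facet_form0; under eq_bigr do rewrite mxE.
by apply/eqP; rewrite eq_sym -addr_eq0 g0.
Qed.

Lemma facet_form_continuous i : continuous (facet_form^~ i).
Proof.
rewrite /facet_form; case: unlift => [j|]; first exact: coord_continuous.
move=> x; apply: continuousN.
apply: (@continuous_big R _ +%R 0 xpredT); first exact: add_continuous.
by move=> j _; exact: coord_continuous.
Qed.

Lemma slab_convex a b : convex_set (slab a b).
Proof.
apply/convex_setP => x y l /andP[l0 l1] xab yab i.
rewrite facet_form_linear facet_formZ.
by have /andP[? ?] := xab i; have /andP[? ?] := yab i; apply/andP; split; nra.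
Qed.

Lemma slab_compact a b : compact (slab a b).
Proof.
have closed_slab : closed (slab a b).
  have -> : slab a b =
      \bigcap_(i in [set: 'I_n.+1]) (facet_form^~ i @^-1` `[a i, b i]%classic).
    apply/seteqP; split=> x xab i; first by move=> _; rewrite /= in_itv /=.
    by have := xab i I; rewrite /= in_itv.
  apply: closed_bigI => i _; apply: preimage_closed.
    by move=> x _; exact: facet_form_continuous.
  exact: itv_closed.
have box := @rV_compact R n
  (fun j => `[a (lift ord0 j), b (lift ord0 j)]%classic)
  (fun j => @segment_compact R _ _).
apply: (subclosed_compact closed_slab box) => x xab j.
by have := xab (lift ord0 j); rewrite facet_form_lift /= in_itv.
Qed.

Definition std_simplex : set V :=
  slab (fun i => - (i == ord0)%:R) (fun i => 1 - (i == ord0)%:R).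

Lemma facet_form_vertex i : facet_form (vertex i) i = (i != ord0)%:R.
Proof.
rewrite /vertex; case: (unliftP ord0 i) => [j ->|->].
  by rewrite facet_form_lift mxE !eqxx.
rewrite facet_form0 eqxx; under eq_bigr do rewrite mxE.
by rewrite big1 ?oppr0.
Qed.

Lemma vertex_sum (mu : 'I_n.+1 -> R) :
  \sum_i mu i *: vertex i = \row_j mu (lift ord0 j).
Proof.
rewrite big_ord_recl /vertex unlift_none scaler0 add0r.
rewrite [RHS]row_sum_delta; apply: eq_bigr => j _.
by rewrite liftK mxE.
Qed.

Lemma vertex_independent : affinely_independent vertex.
Proof.
move=> mu mu0; rewrite vertex_sum => /rowP mu_row.
have lift0 j : mu (lift ord0 j) = 0 by have := mu_row j; rewrite !mxE.
move=> i; case: (unliftP ord0 i) => [j ->|->] //.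
by move: mu0; rewrite big_ord_recl big1 ?addr0.
Qed.

Lemma std_simplexE : std_simplex = conv_hull (range vertex).
Proof.
apply/seteqP; split=> [x xT|].
  have -> : x = \sum_i ((i == ord0)%:R + facet_form x i) *: vertex i.
    rewrite vertex_sum; apply/rowP => j.
    by rewrite mxE facet_form_lift add0r.
  apply: conv_hull_sum => [i|].
    by have /andP[] := xT i; rewrite -subr_ge0 opprK addrC.
  by rewrite big_split /= sum_facet_form addr0 big_ord_recl eqxx big1 ?addr0.
apply: conv_hull_sub; first exact: slab_convex.
move=> _ [k _ <-] i.
case: (unliftP ord0 i) => [j ->|->]; rewrite ?facet_form_lift ?facet_form0.
  have -> : (lift ord0 j == ord0) = false by [].
  rewrite /= subr0 oppr0 /vertex.
  case: unlift => [l|]; rewrite mxE ?lexx ?ler01 //.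
  by rewrite ler0n lern1 leq_b1.
rewrite eqxx subrr /vertex; case: unlift => [l|].
  have -> : \sum_j (delta_mx 0 l : V) 0 j = 1.
    rewrite (bigD1 l) //= mxE !eqxx big1 ?addr0 // => j /negPf jl.
    by rewrite mxE jl andbF.
  by rewrite lexx oppr_le0 ler01.
by rewrite big1 ?oppr0 ?lexx ?lerN10 // => j _; rewrite mxE.
Qed.

Lemma std_simplex_is_simplex : is_simplex std_simplex.
Proof.
by exists vertex; split; [exact: vertex_independent | exact: std_simplexE].
Qed.

Lemma vertex_in i : std_simplex (vertex i).
Proof. by rewrite std_simplexE; apply: sub_conv_hull; exists i. Qed.

(** This family interpolates between the symmetric body at [s = 1] and the
    simplex at [s = n], with the same upper bound throughout: the circumradius
    of [std_simplex] only sees the upper bound, the asymmetry sees [s]. *)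
Definition truncated_simplex (s : R) : set V := slab (fun=> - s) (fun=> 1).

Section Truncated.
Variable s : R.
Hypotheses (n_gt0 : (0 < n)%N) (s_ge1 : 1 <= s) (s_le_n : s <= n%:R).
Local Notation C := (truncated_simplex s).

Let s_gt0 : 0 < s. Proof. exact: lt_le_trans s_ge1. Qed.

Lemma truncated_simplex_interior : interior C 0.
Proof.
have zero i : facet_form 0 i = 0 by rewrite -(scaler0 V 0) facet_formZ mul0r.
have FF : Filter (nbhs (0 : V)) := nbhs_filter _.
have : \forall x \near (0 : V),
    forall i, `|facet_form 0 i - facet_form x i| < 1.
  apply: (@filter_forall _ _ _ _ FF) => i.
  by have /cvgrPdist_lt := @facet_form_continuous i 0; apply.
apply: (@filterS _ _ FF) => x x1 i /=; have := x1 i.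
rewrite zero sub0r normrN ltr_norml => /andP[lo up].
by rewrite (ltW up) (le_trans _ (ltW lo)) ?lerN2.
Qed.

Lemma truncated_simplex_scale x : C x -> C (- s^-1 *: x).
Proof.
move=> Cx i /=; have /= /andP[lo up] := Cx i; rewrite facet_formZ mulNr -mulrN.
apply/andP; split; last by rewrite ler_pdivrMl // mulr1 lerNl.
rewrite ler_pdivlMl //; have := s_ge1; nra.
Qed.

(** The values [facet_form t i] at a translation [t] add up to zero, so one of
    them is nonnegative; a point of [C] at which this form is [- s] then needs
    the factor [s]. *)
Lemma truncated_simplex_asymmetry : minkowski_asymmetry C = s.
Proof.
have CN x : C x -> dilate s (-%R @` C) (x - 0).
  move=> /truncated_simplex_scale Cx; exists (s^-1 *: x).
    by exists (- s^-1 *: x); rewrite // scaleNr opprK.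
  by rewrite subr0 scalerA divff ?scale1r ?gt_eqF.
apply/eqP; rewrite eq_le (circumradius_le (ltW s_gt0) CN) /=.
apply: (circumradius_ge (ltW s_gt0) CN) => r t r_ge0 Ct.
have [i ti] : exists i, 0 <= facet_form t i.
  apply: contrapT => neg; have := sum_facet_form t; apply/eqP.
  have lt0 i : facet_form t i < 0.
    by rewrite ltNge; apply/negP => ge0; apply: neg; exists i.
  rewrite lt_eqF // big_ord_recl ltr_wnDr //.
  by apply: sumr_le0 => j _; exact: ltW.
pose g j := if j == i then - s else s / n%:R.
have n_neq0 : n%:R != 0 :> R by rewrite pnatr_eq0 -lt0n.
have [x xg] : exists x, forall j, facet_form x j = g j.
  apply: facet_form_onto; rewrite (bigD1 i) //= /g eqxx.
  under eq_bigr => j /negPf ji do rewrite ji.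
  rewrite sumr_const cardC1 card_ord -[_ *+ _]mulr_natr divfK //=.
  exact: addNr.
have Cx : C x.
  move=> j; rewrite xg /g; case: ifP => _.
    by rewrite lexx /=; have := s_gt0; lra.
  rewrite ler_pdivrMr ?ltr0n // mul1r s_le_n andbT.
  have : 0 <= s / n%:R by rewrite divr_ge0 // ltW.
  by have := s_gt0; lra.
have [_ [y Cy <-] yE] := Ct x Cx.
have := congr1 (facet_form^~ i) yE.
rewrite /= facet_formZ facet_formN facet_formB.
by rewrite xg /g eqxx => eq; have /andP[_ yi] := Cy i; nra.
Qed.

Lemma truncated_simplex_centered : minkowski_centered C.
Proof.
rewrite /minkowski_centered truncated_simplex_asymmetry => x.
move=> /truncated_simplex_scale Cx; exists (- s^-1 *: x) => //.
by rewrite scalerA mulrNN divff ?scale1r ?gt_eqF.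
Qed.

Lemma std_simplex_sub x y : std_simplex x -> std_simplex y -> C (x - y).
Proof.
move=> Tx Ty i /=; rewrite facet_formB.
have /= /andP[? ?] := Tx i; have /= /andP[? ?] := Ty i.
by have := s_ge1 => ?; apply/andP; split; lra.
Qed.

(** Each vertex is at height [1] over its opposite facet, and the heights of the
    translation vector add up to zero. *)
Lemma std_simplex_circumradius : n%:R / n.+1%:R <= circumradius std_simplex C.
Proof.
have T0 : std_simplex 0 by have := vertex_in ord0; rewrite /vertex unlift_none.
have TC x : std_simplex x -> dilate 1 C (x - 0).
  by move=> Tx; exists (x - 0); [exact: std_simplex_sub | rewrite scale1r].
apply: (circumradius_ge ler01 TC) => r t r_ge0 Ct.
have vertex_le i : (i != ord0)%:R - facet_form t i <= r.
  have [y Cy yE] := Ct _ (vertex_in i).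
  have := congr1 (facet_form^~ i) yE; rewrite /= facet_formZ facet_formB.
  by rewrite facet_form_vertex => <-; have /andP[_ yi] := Cy i; nra.
have : \sum_i ((i != ord0)%:R - facet_form t i) <= \sum_(i < n.+1) r.
  by apply: ler_sum => i _; exact: vertex_le.
rewrite sumrB sum_facet_form subr0 sumr_const card_ord big_ord_recl eqxx add0r.
rewrite ler_pdivrMr ?ltr0n // mulr_natr; apply: le_trans.
by rewrite big_const_ord iter_addr addr0.
Qed.

End Truncated.
End Extremal.

Theorem corollary6p4 (R : realType) (n : nat) (n_ge2 : (2 <= n)%N) :
  (forall K C : set 'rV[R]_n,
     convex_body K -> ~ (exists x, K = [set x]) ->
     convex_body C -> minkowski_centered C -> interior C 0 ->
     (n%:R + 1) / (2 * n%:R) <= min_diameter K C / (2 * circumradius K C) /\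
     ((n%:R + 1) / (2 * n%:R) = min_diameter K C / (2 * circumradius K C) ->
        is_simplex K)) /\
  (forall s : R, 1 <= s <= n%:R ->
     exists K C : set 'rV[R]_n,
       [/\ convex_body C, minkowski_centered C, interior C 0,
           minkowski_asymmetry C = s & is_simplex K] /\
       (n%:R + 1) / (2 * n%:R) = min_diameter K C / (2 * circumradius K C)).
Proof.
have n_gt0 : (0 < n)%N := ltnW n_ge2.
have n_neq0 : n%:R != 0 :> R by rewrite pnatr_eq0 -lt0n.
have N_neq0 : n%:R + 1 != 0 :> R by rewrite natr1 pnatr_eq0.
set c : R := n%:R / n.+1%:R.
have cE : c = n%:R / (n%:R + 1) by rewrite natr1.
have c_gt0 : 0 < c by rewrite divr_gt0 ?ltr0n.
have ratioE (d r : R) : 0 < r ->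
    (n%:R + 1) / (2 * n%:R) = d / (2 * r) -> c * d = r.
  move=> r_gt0 /(congr1 ( *%R^~ (c * 2 * r))); have r_neq0 := lt0r_neq0 r_gt0.
  have -> : d / (2 * r) * (c * 2 * r) = c * d by field.
  by move=> <-; rewrite cE; field; rewrite N_neq0 n_neq0.
split=> [K C bodyK not_point [_ kC cC] _ C0|s /andP[s_ge1 s_le_n]].
  have [r_gt0 r_le simplexK] :=
    circumradius_le_min_diameter cC kC C0 n_gt0 bodyK not_point.
  split; last by move=> /(ratioE _ _ r_gt0) dr; apply: simplexK; rewrite -/c dr.
  rewrite ler_pdivlMr ?mulr_gt0 //.
  have -> : (n%:R + 1) / (2 * n%:R) * (2 * circumradius K C) =
      circumradius K C / c by rewrite cE; field; rewrite N_neq0 n_neq0.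
  by rewrite ler_pdivrMr // mulrC.
pose C : set 'rV[R]_n := truncated_simplex s.
pose K : set 'rV[R]_n := std_simplex.
have C0 : interior C 0 := truncated_simplex_interior s_ge1.
have kC : compact C := @slab_compact _ _ _ _.
have cC : convex_set C := @slab_convex _ _ _ _.
have K0 : K 0 by have := @vertex_in R n ord0; rewrite /vertex unlift_none.
exists K, C; split.
  split=> //.
  - by split=> //; exists 0; exact: (interior_subset C0).
  - exact: truncated_simplex_centered.
  - exact: truncated_simplex_asymmetry.
  - exact: std_simplex_is_simplex.
have bodyK : convex_body K.
  by split; [exists 0 | exact: slab_compact | exact: slab_convex].
have not_point : ~ exists x, K = [set x].
  move=> [x Kx]; pose j := Ordinal n_gt0.
  have in_x y : K y -> y = x by rewrite Kx.
  have := in_x _ (@vertex_in R n (lift ord0 j)); rewrite -(in_x _ K0).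
  rewrite /vertex liftK => /rowP /(_ j) /eqP; rewrite !mxE !eqxx.
  by rewrite oner_eq0.
have [r_gt0 r_le _] :=
  circumradius_le_min_diameter cC kC C0 n_gt0 bodyK not_point.
have r_ge : c <= circumradius K C := std_simplex_circumradius s_ge1.
have d_le1 : min_diameter K C <= 1.
  apply: min_diameter_le; [by exists 0 | exact: ler01 |] => x y Kx Ky.
  by exists (x - y); [exact: std_simplex_sub | rewrite scale1r].
have d1 : min_diameter K C = 1.
  apply/eqP; rewrite eq_le d_le1 /= -(ler_pM2l c_gt0) mulr1.
  exact: le_trans r_ge r_le.
have rE : circumradius K C = c.
  by apply/eqP; rewrite eq_le r_ge andbT; move: r_le; rewrite d1 mulr1.
by rewrite d1 rE cE; field; rewrite N_neq0 n_neq0.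
Qed.
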